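(* The following statements are equivalent: (i) $\mathcal{K}\cap(\{0_Y\}\times\mathbb{R})=\mathcal{M}\cap(\{0_Y\}\times\mathbb{R})$; (ii) for any $\alpha\in\mathbb{R}$, the following two assertions (a) and (b) are equivalent: (a) for all $x\in P$ such that $Ax-b\in Q$, we have $\langle x,c\rangle\ge\alpha$; (b) there exists $w\in Q^*$ such that $-A^*w+c\in P^*$ and $\langle b,w\rangle\ge\alpha$.
   Context: Setting: $(X,Y)$ and $(Z,W)$ are separated dual pairs of real vector spaces, i.e. there are bilinear forms on $X\times Y$ and on $Z\times W$, both denoted $\langle\cdot,\cdot\rangle$, such that $\langle x_0,y\rangle=0$ for all $y\in Y$ implies $x_0=0$, and $\langle x,y_0\rangle=0$ for all $x\in X$ implies $y_0=0$ (and likewise for $(Z,W)$). No topology is assumed. $A:X\to Z$ is a linear map with adjoint $A^*:W\to Y$, a linear map satisfying $\langle x,A^*w\rangle=\langle Ax,w\rangle$ for all $x\in X$, $w\in W$ (assumed to exist). $P\subset X$ and $Q\subset Z$ are convex cones (nonempty, and $\alpha u+\beta v$ is in the cone for all $\alpha,\beta\ge 0$ and $u,v$ in the cone); $b\in Z$, $c\in Y$. Dual cones: $P^*=\{y\in Y:\langle x,y\rangle\ge 0\ \forall x\in P\}$, $Q^*=\{w\in W:\langle q,w\rangle\ge 0\ \forall q\in Q\}$. Feasible sets: $F(\mathcal{P})=\{x\in P: Ax-b\in Q\}$ and $F(\mathcal{D})=\{w\in Q^*:-A^*w+c\in P^*\}$; both are assumed nonempty. Definitions: $\mathcal{K}=\bigcup_{w\in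 Q^*}\big((-A^*w+c-P^* )\times\,]-\infty,\langle b,w\rangle]\big)\subset Y\times\mathbb{R}$; $v_{\mathcal{P}}(y)=\inf\{\langle x,c-y\rangle:x\in F(\mathcal{P})\}$ for $y\in Y$ (possibly $-\infty$); $\mathcal{M}=\mathrm{hypo}\,v_{\mathcal{P}}=\{(y,r)\in Y\times\mathbb{R}: r\le v_{\mathcal{P}}(y)\}$. $0_Y$ is the zero vector of $Y$. *)

(* Defs.v *)
From mathcomp Require Import all_boot all_order all_algebra.
From mathcomp Require Import mathcomp_extra boolp classical_sets set_interval.
From mathcomp Require Import reals ereal.

Set Implicit Arguments.
Unset Strict Implicit.
Unset Printing Implicit Defensive.

Import Order.TTheory GRing.Theory Num.Theory.

Local Open Scope classical_set_scope.
Local Open Scope ring_scope.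

Definition separated_pairing (R : realType) (U V : lmodType R)
    (dual : {bilinear U -> V -> R | *%R & *%R}) : Prop :=
  (forall u, (forall v, dual u v = 0) -> u = 0) /\
  (forall v, (forall u, dual u v = 0) -> v = 0).

Definition convex_cone (R : realType) (V : lmodType R) (C : set V) : Prop :=
  C !=set0 /\
  forall (a b : R) (u v : V),
    0 <= a -> 0 <= b -> C u -> C v -> C (a *: u + b *: v).

Definition dual_cone (R : realType) (U V : lmodType R)
    (dual : {bilinear U -> V -> R | *%R & *%R}) (C : set U) : set V :=
  [set v | forall u, C u -> 0 <= dual u v].

Definition primal_feasible (R : realType) (X Z : lmodType R)
    (A : {linear X -> Z}) (P : set X) (Q : set Z) (b : Z) : set X :=
  [set x | P x /\ Q (A x - b)].

Definition dual_feasible (R : realType) (X Y Z W : lmodType R)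
    (dualXY : {bilinear X -> Y -> R | *%R & *%R})
    (dualZW : {bilinear Z -> W -> R | *%R & *%R})
    (Astar : {linear W -> Y}) (P : set X) (Q : set Z) (c : Y) : set W :=
  [set w | dual_cone dualZW Q w /\ dual_cone dualXY P (- Astar w + c)].

(* The image set is the Minkowski difference - Astar w + c - P^*. *)
Definition setK (R : realType) (X Y Z W : lmodType R)
    (dualXY : {bilinear X -> Y -> R | *%R & *%R})
    (dualZW : {bilinear Z -> W -> R | *%R & *%R})
    (Astar : {linear W -> Y}) (P : set X) (Q : set Z) (b : Z) (c : Y) :
    set (Y * R) :=
  \bigcup_(w in dual_cone dualZW Q)
    ([set - Astar w + c - p | p in dual_cone dualXY P] `*`
     [set` `]-oo, dualZW b w]]).

(* Extended-real valued, as the infimum may be -oo. The vector y perturbs the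
   objective only; the feasible set is unchanged. *)
Definition primal_value (R : realType) (X Y Z : lmodType R)
    (dualXY : {bilinear X -> Y -> R | *%R & *%R})
    (A : {linear X -> Z}) (P : set X) (Q : set Z) (b : Z) (c y : Y) : \bar R :=
  ereal_inf [set (dualXY x (c - y))%:E | x in primal_feasible A P Q b].

Definition hypograph (R : realType) (T : Type) (f : T -> \bar R) :
    set (T * R) :=
  [set yr | (yr.2%:E <= f yr.1)%E].

Definition setM (R : realType) (X Y Z : lmodType R)
    (dualXY : {bilinear X -> Y -> R | *%R & *%R})
    (A : {linear X -> Z}) (P : set X) (Q : set Z) (b : Z) (c : Y) :
    set (Y * R) :=
  hypograph (primal_value dualXY A P Q b c).

(* Main.v *)
Require Import Defs.
From mathcomp Require Import all_boot all_order all_algebra.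
From mathcomp Require Import mathcomp_extra boolp classical_sets set_interval.
From mathcomp Require Import reals ereal.

Import Order.TTheory GRing.Theory Num.Theory.

Local Open Scope classical_set_scope.
Local Open Scope ring_scope.

(** Both sets of assertion (i) live over the zero of Y, so comparing them amounts
    to comparing the reals r for which (0, r) belongs to each.
    On the dual side, the zero vector lies in the translated cone
    - A^* w + c - P^* exactly when - A^* w + c lies in P^*, so (0, r) is in K iff
    some dual feasible w has value at least r: this is [setK_fiber0], and it is
    assertion (b) for alpha = r. On the primal side, y = 0 leaves the objective
    unperturbed, and r lies below an infimum iff it is a lower bound: this is
    [setM_fiber0], and it is assertion (a) for alpha = r. Hence (i) is the
    pointwise equivalence (a) <-> (b), written as an equality of sets
    ([eq_fiberP]). *)

(** Intersecting with the slice over t forgets everything about K and M but their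
    fibers over t. *)
Lemma eq_fiberP (T U : Type) (t : T) (K M : set (T * U)) :
  K `&` ([set t] `*` [set: U]) = M `&` ([set t] `*` [set: U]) <->
  (forall u, K (t, u) <-> M (t, u)).
Proof.
split=> [/seteqP[KM MK] u|KM].
  by split=> ?; [have [] := KM (t, u) | have [] := MK (t, u)].
by apply/seteqP; split=> -[t' u] /= [h [/= tt' _]]; subst t';
  split=> //; apply/KM.
Qed.

(** Zero lies in a translate y - C exactly when y lies in C, so the element of
    P^* that witnesses membership in K can only be - A^* w + c itself. *)
Lemma setK_fiber0 (R : realType) (X Y Z W : lmodType R)
    (dualXY : {bilinear X -> Y -> R | *%R & *%R})
    (dualZW : {bilinear Z -> W -> R | *%R & *%R})
    (Astar : {linear W -> Y}) (P : set X) (Q : set Z) (b : Z) (c : Y) (r : R) :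
  setK dualXY dualZW Astar P Q b c (0, r) <->
  (exists w, [/\ dual_cone dualZW Q w,
                 dual_cone dualXY P (- Astar w + c) &
                 r <= dualZW b w]).
Proof.
split=> [[w Qw [[p Pp /= /subr0_eq wp] /= rw]]|[w [Qw Pw rw]]].
  by exists w; split=> //; rewrite wp.
exists w => //; split=> /=; last by rewrite in_itv.
by exists (- Astar w + c); rewrite ?subrr.
Qed.

(** A real lies below the infimum of the objective values exactly when it is a
    lower bound of them, also when the infimum is infinite. *)
Lemma setM_fiber0 (R : realType) (X Y Z : lmodType R)
    (dualXY : {bilinear X -> Y -> R | *%R & *%R})
    (A : {linear X -> Z}) (P : set X) (Q : set Z) (b : Z) (c : Y) (r : R) :
  setM dualXY A P Q b c (0, r) <->
  (forall x, P x -> Q (A x - b) -> r <= dualXY x c).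
Proof.
rewrite /setM /hypograph /primal_value /= subr0; split=> [r_le x Px Qx|r_lb].
  rewrite -lee_fin; apply: (le_trans r_le).
  by apply: ereal_inf_lbound; exists x.
by apply: le_ereal_inf_tmp => _ [x [Px Qx] <-]; rewrite lee_fin; apply: r_lb.
Qed.

Theorem theorem4p4 (R : realType) (X Y Z W : lmodType R)
    (dualXY : {bilinear X -> Y -> R | *%R & *%R})
    (dualZW : {bilinear Z -> W -> R | *%R & *%R})
    (sepXY : separated_pairing dualXY) (sepZW : separated_pairing dualZW)
    (A : {linear X -> Z}) (Astar : {linear W -> Y})
    (adjA : forall x w, dualXY x (Astar w) = dualZW (A x) w)
    (P : set X) (Q : set Z) (coneP : convex_cone P) (coneQ : convex_cone Q)
    (b : Z) (c : Y)
    (FP_neq0 : primal_feasible A P Q b !=set0)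
    (FD_neq0 : dual_feasible dualXY dualZW Astar P Q c !=set0) :
  (setK dualXY dualZW Astar P Q b c `&` ([set 0] `*` [set: R]) =
   setM dualXY A P Q b c `&` ([set 0] `*` [set: R]))
  <->
  (forall alpha : R,
     (forall x, P x -> Q (A x - b) -> alpha <= dualXY x c)
     <->
     (exists w, [/\ dual_cone dualZW Q w,
                    dual_cone dualXY P (- Astar w + c) &
                    alpha <= dualZW b w])).
Proof.
apply: (iff_trans (eq_fiberP _ _ _ _ _)).
split=> KM r; apply: iff_sym.
  by rewrite -setK_fiber0 -(setM_fiber0 _ _ _ _ dualXY A).
by rewrite setK_fiber0 setM_fiber0.
Qed.
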